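(* For every permutation $\sigma\in S_n$, we have $|s^{-1}(\sigma)|\leq|s^{-1}(s(\sigma))|$, and equality holds if and only if $\sigma=123\cdots n$.
   Context: $S_n$ is the set of permutations of $[n]$ in one-line notation. West's stack-sorting map $s$ is defined recursively: $s$ sends the empty permutation to itself, and if $\pi=LmR$ is nonempty with $m$ its largest entry, then $s(\pi)=s(L)\,s(R)\,m$. Here $s^{-1}(\sigma)=\{\tau\in S_n: s(\tau)=\sigma\}$, and $|s^{-1}(\sigma)|$ is called the fertility of $\sigma$. *)

(* Defs.v *)
From mathcomp Require Import all_boot.

Set Implicit Arguments.
Unset Strict Implicit.
Unset Printing Implicit Defensive.

(* The first argument is fuel: any value at least the length of the word gives
   the recursion s(LmR) = s(L) s(R) m, see stack_sort_word_cat below. *)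
Fixpoint stack_sort_rec (k : nat) (w : seq nat) : seq nat :=
  match k, w with
  | k'.+1, _ :: _ =>
      let m := \max_(x <- w) x in
      let i := index m w in
      stack_sort_rec k' (take i w) ++ stack_sort_rec k' (drop i.+1 w) ++ [:: m]
  | _, _ => [::]
  end.

Definition stack_sort_word (w : seq nat) : seq nat := stack_sort_rec (size w) w.

Lemma max_mem_seq (w : seq nat) : w != [::] -> \max_(x <- w) x \in w.
Proof.
elim: w => [//|x [|y w] IH] _; first by rewrite big_seq1 inE.
rewrite big_cons /maxn; case: ifP => _; last by rewrite inE eqxx.
by rewrite inE IH ?orbT.
Qed.

Lemma stack_sort_rec_fuel (k : nat) (w : seq nat) :
  size w <= k -> stack_sort_rec k w = stack_sort_word w.
Proof.
rewrite /stack_sort_word; move: {2}(size w) (leqnn (size w)) => j.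
elim: j k w => [|j IH] [|k] [|x w] //= lewj lewk.
set u := x :: w; set m := \max_(y <- u) y; set i := index m u.
have lti : i < (size w).+1.
  by rewrite -[(size w).+1]/(size u) index_mem max_mem_seq.
have szt : size (take i u) <= size w by rewrite size_take_min geq_min -ltnS lti.
have szd : size (drop i w) <= size w by rewrite size_drop leq_subr.
rewrite !ltnS in lewj lewk.
rewrite !(IH k) ?(IH (size w)) ?(leq_trans szt) ?(leq_trans szd) //.
Qed.

Lemma stack_sort_word_cat (L R : seq nat) (m : nat) :
  all (ltn^~ m) L -> all (leq^~ m) R ->
  stack_sort_word (L ++ m :: R) =
    stack_sort_word L ++ stack_sort_word R ++ [:: m].
Proof.
move=> /allP ltL /allP leR.
have maxE : \max_(x <- L ++ m :: R) x = m.
  apply/eqP; rewrite eqn_leq; apply/andP; split.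
    apply/bigmax_leqP_seq => x; rewrite mem_cat inE.
    case/or3P=> [/ltL/ltnW//|/eqP->//|/leR//].
  by apply: leq_bigmax_seq => //; rewrite mem_cat inE eqxx orbT.
have idxE : index m (L ++ m :: R) = size L.
  rewrite index_cat ifF /= ?eqxx ?addn0 //.
  by apply/negP => /ltL /=; rewrite ltnn.
rewrite {1}/stack_sort_word size_cat /= addnS.
have recE k u : u != [::] -> let i := index (\max_(x <- u) x) u in
    stack_sort_rec k.+1 u = stack_sort_rec k (take i u) ++
      stack_sort_rec k (drop i.+1 u) ++ [:: \max_(x <- u) x].
  by case: u.
rewrite recE; last by case: (L).
rewrite maxE idxE take_size_cat //.
rewrite -(cat_rcons m L R) drop_size_cat ?size_rcons //.
by rewrite !stack_sort_rec_fuel ?leq_addl ?leq_addr.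
Qed.

Lemma perm_stack_sort_rec (k : nat) (w : seq nat) :
  size w <= k -> perm_eq (stack_sort_rec k w) w.
Proof.
elim: k w => [|k IH] [|x w] //= lewk.
set u := x :: w; set m := \max_(y <- u) y; set i := index m u.
have mu : m \in u by exact: max_mem_seq.
have lti : i < size u by rewrite index_mem.
have szt : size (take i u) <= k.
  by rewrite size_take_min geq_min -ltnS (leq_trans lti lewk).
have szd : size (drop i w) <= k by rewrite size_drop (leq_trans (leq_subr _ _)).
rewrite -[X in perm_eq _ X](cat_take_drop i u) (drop_nth m lti) nth_index //=.
by apply: perm_cat (IH _ szt) _; rewrite perm_catC perm_cons IH.
Qed.

Lemma perm_stack_sort_word (w : seq nat) : perm_eq (stack_sort_word w) w.
Proof. exact: perm_stack_sort_rec. Qed.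

(* Permutations of {1, ..., n} in one-line notation, as words. *)
Definition perms (n : nat) : finType := seq_sub (permutations (iota 1 n)).

Definition one_line (n : nat) (sigma : perms n) : seq nat := ssval sigma.

Lemma stack_sort_subproof (n : nat) (sigma : perms n) :
  stack_sort_word (one_line sigma) \in permutations (iota 1 n).
Proof.
rewrite mem_permutations (perm_trans (perm_stack_sort_word _)) //.
by rewrite -mem_permutations; exact: ssvalP.
Qed.

Definition stack_sort (n : nat) (sigma : perms n) : perms n :=
  SeqSub (stack_sort_subproof sigma).

Definition fertility (n : nat) (sigma : perms n) : nat :=
  #|[set tau : perms n | stack_sort tau == sigma]|.

(* Main.v *)
Require Import Defs.
From mathcomp Require Import all_boot zify.

Set Implicit Arguments.
Unset Strict Implicit.
Unset Printing Implicit Defensive.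

(** Let [fert w] be the number of preimages of a word [w].  It vanishes unless
    the last letter of [w] is its maximum, and
    [fert (w m) = \sum_(w = w1 w2) fert w1 * fert w2] when [m] exceeds all
    letters of [w].

    Passing from [L m R] to [s(L) s(R) m] is done in context: sort [L], sort
    [R], then move [m] to the right of [s(R)].  So everything reduces to
    comparing [u b X v] with [u X b v], where [b] is larger than [X] and smaller
    than the first letter of [v].  For empty [u] there is the exact formula
    [fert (X b v) =
       fert (b X v) + fert (X v)
         + \sum_(X = X1 X2, X2 <> [::]) fert X1 * fert (X2 v)],
    which gives [fert (u b X v) + fert u * fert (X v) <= fert (u X b v)] whenever
    [b] is larger than [u].  In general a split of [u b X] just after [b]
    contributes only if [b] is larger than [u], so the recursion compares the
    remaining splits term by term. *)

(** * Cutting a word into two factors *)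

Section Splits.

Variable T : eqType.
Implicit Types (u v w : seq T) (p : seq T * seq T).

(** The cut after the last letter is left out, so that in [u ++ w] the cut between [u] and [w] is
    counted once, on the side of [w]. *)
Fixpoint proper_splits w : seq (seq T * seq T) :=
  if w is x :: w' then
    ([::], w) :: [seq (x :: p.1, p.2) | p <- proper_splits w']
  else [::].

Definition splits w : seq (seq T * seq T) :=
  rcons (proper_splits w) (w, [::]).

Lemma mem_proper_splits w p :
  (p \in proper_splits w) = (w == p.1 ++ p.2) && (p.2 != [::]).
Proof.
case: p => u v /=; elim: w u => [|x w IH] u; first by case: u; case: v.
rewrite inE; case: u => [|y u] /=.
  rewrite orbC; case: mapP => [[q _ []]//|_] /=.
  by rewrite xpair_eqE /= eq_sym; case: eqP => [<-|//].
rewrite eqseq_cons.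
have [->|nxy] /= := eqVneq x y.
  rewrite -IH; apply/mapP/idP => [[[a b] ab [-> ->]]//|uv].
  by exists (u, v).
by apply/mapP => -[q _ [/eqP]]; rewrite eq_sym (negPf nxy).
Qed.

Lemma mem_splits w p : (p \in splits w) = (w == p.1 ++ p.2).
Proof.
rewrite mem_rcons inE mem_proper_splits; case: p => u [|x v] /=.
  by rewrite andbF orbF cats0 xpair_eqE /= eqxx andbT eq_sym.
by rewrite xpair_eqE /= !andbF andbT.
Qed.

Lemma uniq_proper_splits w : uniq (proper_splits w).
Proof.
elim: w => //= x w IH; rewrite map_inj_uniq ?IH ?andbT; last first.
  by move=> [a b] [c d] [-> ->].
by apply/mapP => -[].
Qed.

Lemma uniq_splits w : uniq (splits w).
Proof. by rewrite rcons_uniq uniq_proper_splits mem_proper_splits /= andbF. Qed.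

Lemma proper_splits_cat u w :
  proper_splits (u ++ w) =
    [seq (p.1, p.2 ++ w) | p <- proper_splits u] ++
    [seq (u ++ p.1, p.2) | p <- proper_splits w].
Proof.
elim: u => [|x u IH] /=; first by rewrite -[LHS]map_id; apply: eq_map => -[].
by rewrite IH map_cat -!map_comp.
Qed.

Lemma big_splits (F : seq T -> seq T -> nat) w :
  \sum_(p <- splits w) F p.1 p.2 =
    \sum_(p <- proper_splits w) F p.1 p.2 + F w [::].
Proof. by rewrite /splits big_rcons. Qed.

Lemma big_splits_cons (F : seq T -> seq T -> nat) x w :
  \sum_(p <- splits (x :: w)) F p.1 p.2 =
    F [::] (x :: w) + \sum_(p <- splits w) F (x :: p.1) p.2.
Proof.
rewrite big_splits (big_splits (fun a => F (x :: a))) /=.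
by rewrite big_cons big_map addnA.
Qed.

Lemma big_splits_cat (F : seq T -> seq T -> nat) u w :
  \sum_(p <- splits (u ++ w)) F p.1 p.2 =
    \sum_(p <- proper_splits u) F p.1 (p.2 ++ w) +
    \sum_(p <- splits w) F (u ++ p.1) p.2.
Proof.
rewrite big_splits (big_splits (fun a => F (u ++ a))).
by rewrite proper_splits_cat big_cat !big_map /= addnA.
Qed.

End Splits.

Lemma leq_sum_seq (I : eqType) (r : seq I) (F G : I -> nat) :
  {in r, forall i, F i <= G i} -> \sum_(i <- r) F i <= \sum_(i <- r) G i.
Proof. by move=> h; rewrite !big_seq; apply: leq_sum. Qed.

(** * Preimages under the stack-sorting map *)

(** Inverts [s(LmR) = s(L) s(R) m]: the last letter of [w] is the maximum of a preimage, and each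
    cut of the rest prescribes [s(L)] and [s(R)]. The value at fuel zero matters only for the empty
    word, since the fuel stays at least the length. *)
Fixpoint preimages_rec (k : nat) (w : seq nat) : seq (seq nat) :=
  if k is k'.+1 then
    if w is x :: w' then
      let z := belast x w' in let m := last x w' in
      if all (ltn^~ m) z then
        [seq q.1 ++ m :: q.2 | p <- splits z,
           q <- [seq (a, b) | a <- preimages_rec k' p.1,
                              b <- preimages_rec k' p.2]]
      else [::]
    else [:: [::]]
  else [:: [::]].

Definition preimages (w : seq nat) : seq (seq nat) := preimages_rec (size w) w.

Lemma preimages_rec_fuel k w :
  size w <= k -> preimages_rec k w = preimages w.
Proof.
rewrite /preimages; move: {2}(size w) (leqnn (size w)) => j.
elim: j k w => [|j IH] [|k] [|x w] //= lewj lewk.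
case: ifP => // _; congr flatten; apply/eq_in_map => -[a b].
rewrite mem_splits /= => /eqP zE.
have := size_belast x w; rewrite zE size_cat => sz.
by rewrite !(IH k) ?(IH (size w)) //; lia.
Qed.

Lemma preimages_rcons w m :
  preimages (rcons w m) =
    if all (ltn^~ m) w then
      [seq q.1 ++ m :: q.2 | p <- splits w,
         q <- [seq (a, b) | a <- preimages p.1, b <- preimages p.2]]
    else [::].
Proof.
rewrite {1}/preimages size_rcons.
have -> k : preimages_rec k.+1 (rcons w m) =
    if all (ltn^~ m) w then
        [seq q.1 ++ m :: q.2 | p <- splits w,
           q <- [seq (a, b) | a <- preimages_rec k p.1,
                              b <- preimages_rec k p.2]]
      else [::].
  case: w => [//|x w]; rewrite rcons_cons /= last_rcons belast_rcons.
  by [].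
case: ifP => // _; congr flatten; apply/eq_in_map => -[a b].
rewrite mem_splits /= => /eqP zE.
by rewrite !preimages_rec_fuel // zE size_cat; lia.
Qed.

Lemma stack_sort_word_split L R m :
  all (ltn^~ m) L -> all (ltn^~ m) R ->
  stack_sort_word (L ++ m :: R) =
    rcons (stack_sort_word L ++ stack_sort_word R) m.
Proof.
move=> hL hR; rewrite stack_sort_word_cat ?cats1 -?cats1 ?catA //.
by apply: sub_all hR => x /ltnW.
Qed.

Lemma all_stack_sort (a : pred nat) w : all a (stack_sort_word w) = all a w.
Proof. exact/perm_all/perm_stack_sort_word. Qed.

(** Induction along the recursion of the stack-sorting map; distinct letters make the maximum strict
    on both sides. *)
Lemma uniq_max_ind (P : seq nat -> Prop) :
  P [::] ->
  (forall L m R, all (ltn^~ m) L -> all (ltn^~ m) R -> uniq L -> uniq R ->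
     P L -> P R -> P (L ++ m :: R)) ->
  forall w, uniq w -> P w.
Proof.
move=> P0 PS w; have [k] := ubnP (size w); elim: k w => // k IH w lewk uw.
have [->//|w0] := eqVneq w [::].
have mw := max_mem_seq w0; set m := \max_(x <- w) x in mw.
have maxm x : x \in w -> x <= m by move=> xw; apply: leq_bigmax_seq.
case/splitPr: mw uw lewk maxm => L R; rewrite cat_uniq /= size_cat /=.
rewrite addnS ltnS; case/and4P=> uL /norP[mL _] mR uR lewk maxm.
apply: PS => //.
- apply/allP => x xL; rewrite /= ltn_neqAle maxm ?mem_cat ?xL // andbT.
  by apply: contraNneq mL => <-.
- apply/allP => x xR; rewrite /= ltn_neqAle maxm ?mem_cat ?inE ?xR ?orbT //.
  by rewrite andbT; apply: contraNneq mR => <-.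
- by apply: IH uL; apply: leq_ltn_trans lewk; apply: leq_addr.
- by apply: IH uR; apply: leq_ltn_trans lewk; apply: leq_addl.
Qed.

Lemma stack_sort_preimages w t : t \in preimages w -> stack_sort_word t = w.
Proof.
have [k] := ubnP (size w); elim: k w t => // k IH.
case/lastP => [|w m] t szw; first by rewrite inE => /eqP->.
rewrite preimages_rcons; case: ifP => // hw.
case/allpairsPdep=> -[a b] [[c d]] [].
rewrite mem_splits /= => /eqP wE /allpairsP[[c' d']] [/= hc hd [-> ->]] ->.
move: szw hw; rewrite wE size_rcons size_cat all_cat => szw /andP[ha hb].
have cE : stack_sort_word c' = a by apply: IH hc; lia.
have dE : stack_sort_word d' = b by apply: IH hd; lia.
by rewrite stack_sort_word_split ?cE ?dE // -all_stack_sort ?cE ?dE.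
Qed.

Lemma mem_preimages t : uniq t -> t \in preimages (stack_sort_word t).
Proof.
move: t; apply: uniq_max_ind => // L m R hL hR _ _ iL iR.
rewrite stack_sort_word_split // preimages_rcons all_cat !all_stack_sort hL hR.
apply/allpairsPdep; exists (stack_sort_word L, stack_sort_word R), (L, R).
split=> //; first by rewrite mem_splits.
by apply/allpairsP; exists (L, R).
Qed.

Lemma uniq_preimages w : uniq (preimages w).
Proof.
have [k] := ubnP (size w); elim: k w => // k IH.
case/lastP => [//|w m] szw; rewrite preimages_rcons; case: ifP => // hw.
rewrite size_rcons in szw.
apply: allpairs_uniq_dep; first exact: uniq_splits.
  move=> [a b]; rewrite mem_splits /= => /eqP wE.
  rewrite wE size_cat in szw.
  apply: allpairs_uniq => [||[? ?] [? ?] //].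
    by apply: IH => /=; lia.
  by apply: IH => /=; lia.
move=> x y /allpairsPdep[[a b] [[c d] [ab cd ->]]].
case/allpairsPdep=> [[a' b'] [[c' d'] [ab' cd' ->]]] /= cdE.
move: cd cd' => /allpairsP[[? ?]] [/= hc hd [? ?]].
case/allpairsP=> [[? ?]] [/= hc' hd' [? ?]]; subst.
move: ab ab'; rewrite !mem_splits /= => /eqP wE /eqP wE'.
(* [m] is absent from the left half of a preimage, so its index recovers that half, and sorting both
   halves recovers the cut. *)
have mN a0 b0 c0 : w = a0 ++ b0 -> c0 \in preimages a0 -> m \notin c0.
  move=> w0 /stack_sort_preimages c0E; apply/negP => mc.
  move: hw; rewrite w0 all_cat -c0E all_stack_sort => /andP[/allP/(_ m mc)].
  by rewrite /= ltnn.
have idx e g : m \notin e -> index m (e ++ m :: g) = size e.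
  by move=> /negPf he; rewrite index_cat he /= eqxx addn0.
have sz := congr1 (index m) cdE.
rewrite (idx _ _ (mN _ _ _ wE hc)) (idx _ _ (mN _ _ _ wE' hc')) in sz.
move/eqP: cdE; rewrite eqseq_cat // => /andP[/eqP E1 /eqP[E2]].
move: hc hd hc' hd'; rewrite -E1 -E2.
by do 4!move=> /stack_sort_preimages <-.
Qed.

Definition fert (w : seq nat) : nat := size (preimages w).

Lemma fert_rcons w m :
  fert (rcons w m) =
    if all (ltn^~ m) w then \sum_(p <- splits w) fert p.1 * fert p.2 else 0.
Proof.
rewrite /fert preimages_rcons; case: ifP => // _.
rewrite size_allpairs_dep sumnE big_map; apply: eq_bigr => p _.
by rewrite size_allpairs.
Qed.

Lemma fertility_fert n (sigma : perms n) :
  fertility sigma = fert (one_line sigma).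
Proof.
rewrite /fertility cardE -(size_map (@one_line n)).
apply/perm_size/uniq_perm; last 1 first.
- move=> t; apply/mapP/idP => [[tau]|ht].
    rewrite mem_enum inE => /eqP <- ->.
    have := ssvalP tau; rewrite mem_permutations => /perm_uniq pt.
    by apply: mem_preimages; rewrite /one_line pt iota_uniq.
  have tE := stack_sort_preimages ht.
  have tP : t \in permutations (iota 1 n).
    rewrite mem_permutations -(permPl (perm_stack_sort_word t)) tE.
    by rewrite -mem_permutations; apply: ssvalP.
  exists (SeqSub tP) => //; rewrite mem_enum inE.
  by apply/eqP/val_inj.
- by rewrite map_inj_uniq ?enum_uniq //; apply: val_inj.
- exact: uniq_preimages.
Qed.

(** * Moving a letter to the right of a run of smaller letters *)

Lemma fert1 b : fert [:: b] = 1.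
Proof. by rewrite (fert_rcons [::]) /= big_seq1. Qed.

Lemma fert_cat_rcons_eq0 u v m :
  ~~ all (ltn^~ m) v -> fert (u ++ rcons v m) = 0.
Proof.
by move=> hv; rewrite -rcons_cat fert_rcons all_cat (negPf hv) andbF.
Qed.

Lemma fert_descent_eq0 u b X :
  X != [::] -> all (ltn^~ b) X -> fert (u ++ b :: X) = 0.
Proof.
case/lastP: X => [//|X x] _; rewrite all_rcons -rcons_cons => /andP[xb _].
apply: fert_cat_rcons_eq0 => /=.
by rewrite negb_and -leqNgt ltnW.
Qed.

Lemma fert_cat_rcons u v m :
  all (ltn^~ m) u -> all (ltn^~ m) v ->
  fert (u ++ rcons v m) =
    \sum_(p <- proper_splits u) fert p.1 * fert (p.2 ++ v) +
    \sum_(p <- splits v) fert (u ++ p.1) * fert p.2.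
Proof.
move=> hu hv; rewrite -rcons_cat fert_rcons all_cat hu hv.
exact: (big_splits_cat (fun a b => fert a * fert b)).
Qed.

Definition gt_head (b : nat) (v : seq nat) : bool :=
  if v is c :: _ then b < c else true.

(** The recursion for [fert] strips the last letter [m] and then cuts, so it calls on [v] and on its
    prefixes. If [m] is not above the rest of [v], every word ending in [rcons v m] has fertility
    zero. *)
Lemma gt_head_ind b (Q : seq nat -> Prop) :
  Q [::] ->
  (forall v m, ~~ all (ltn^~ m) v -> Q (rcons v m)) ->
  (forall v m, all (ltn^~ m) v -> b < m -> gt_head b v -> Q v ->
     {in splits v, forall p, Q p.1} -> Q (rcons v m)) ->
  forall v, gt_head b v -> Q v.
Proof.
move=> Q0 QN QS v; have [k] := ubnP (size v); elim: k v => // k IH.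
case/lastP=> [//|v m]; rewrite size_rcons !ltnS => szv hv.
have [vm|] := boolP (all (ltn^~ m) v); last exact: QN.
have bm : b < m.
  case: v hv vm {szv} => [//|c v] /= bc /andP[cm _].
  exact: ltn_trans bc cm.
have hd p : p \in splits v -> Q p.1.
  rewrite mem_splits => /eqP vE; apply: IH.
    by apply: leq_ltn_trans szv; rewrite vE size_cat leq_addr.
  by move: hv; rewrite vE; case: p.1.
apply: QS => //; first by case: v hv {szv vm hd}.
apply: (hd (v, [::])).
by rewrite mem_splits cats0.
Qed.

(* [lia] does not identify sums that differ by canonical instances of index
   types, hence the abstraction, which works up to conversion. *)
Ltac sum_lia :=
  repeat match goal with
  | |- context [bigop.body ?i ?r ?F] => move: (bigop.body i r F)
  end;
  repeat match goal with |- context [fert ?w] => move: (fert w) end;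
  clear; lia.

Section Move.

Variable b : nat.
Implicit Types (u v X : seq nat).

(** A cut inside [X] leaves a left factor ending below [b], of fertility zero. The three terms are
    the cuts up to just before [b], the cut just after [b], and the cuts from the end of [X] on. *)
Lemma fert_descent_rcons u X v m :
  X != [::] -> all (ltn^~ b) X -> b < m ->
  all (ltn^~ m) u -> all (ltn^~ m) v ->
  fert (u ++ b :: X ++ rcons v m) =
    \sum_(p <- splits u) fert p.1 * fert (p.2 ++ b :: X ++ v) +
    fert (rcons u b) * fert (X ++ v) +
    \sum_(p <- splits v) fert (u ++ b :: X ++ p.1) * fert p.2.
Proof.
move=> X0 Xb bm um vm.
have Xm : all (ltn^~ m) X by apply: sub_all Xb => x xb; apply: ltn_trans bm.
rewrite -[b :: _]cat_cons catA fert_cat_rcons ?all_cat ?um /= ?bm ?Xm //.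
congr (_ + _); last by apply: eq_bigr => p _; rewrite -catA.
rewrite (big_splits (fun a c => fert a * fert (c ++ b :: X ++ v))).
rewrite proper_splits_cat big_cat !big_map /= -addnA; congr (_ + _).
  by apply: eq_bigr => p _; rewrite -catA.
rewrite big_cons big_map /= cats0; congr (_ + _).
case: X X0 Xb {Xm} => [//|x X] _ Xb; rewrite /= big_cons big_map /= cats1.
rewrite big_seq big1 ?addn0 // => p.
rewrite mem_proper_splits => /andP[/eqP XE _].
rewrite fert_descent_eq0 //=.
by move: Xb; rewrite /= XE all_cat => /and3P[-> ->].
Qed.

(** Evaluates the sum left over in [fert_move_first]. In the induction on [v], expanding the terms
    with [p.2] nonempty yields the same sum for [v] and for its prefixes, plus terms
    [fert p.1 * fert (p.2 ++ v)], which are the cuts of [X ++ rcons v m] inside [X]. *)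
Lemma fert_contract X v :
  X != [::] -> all (ltn^~ b) X -> gt_head b v ->
  \sum_(p <- splits X) fert p.1 * fert (b :: p.2 ++ v) =
    fert (b :: X ++ v) + fert (X ++ v).
Proof.
move=> X0 Xb; move: v; apply: gt_head_ind => [|v m vm|v m vm bm hv IHv IH].
- rewrite (big_splits (fun a c => fert a * fert (b :: c ++ [::]))) /= !cats0.
  rewrite (fert_descent_eq0 [::] X0 Xb) fert1 muln1 big_seq big1 // => p.
  rewrite mem_proper_splits => /andP[/eqP XE p0].
  rewrite cats0 (fert_descent_eq0 [::]) ?muln0 //.
  by move: Xb; rewrite XE all_cat => /andP[].
- rewrite -[b :: X ++ _]cat_cons !fert_cat_rcons_eq0 // big1 // => p _.
  by rewrite -cat_cons fert_cat_rcons_eq0 ?muln0.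
have Xm : all (ltn^~ m) X by apply: sub_all Xb => x xb; apply: ltn_trans bm.
have E p : p \in proper_splits X ->
    fert p.1 * fert (b :: p.2 ++ rcons v m) =
    fert p.1 * fert (b :: p.2 ++ v) + fert p.1 * fert (p.2 ++ v) +
    \sum_(q <- splits v) fert p.1 * fert (b :: p.2 ++ q.1) * fert q.2.
  rewrite mem_proper_splits => /andP[/eqP XE p0].
  rewrite (fert_descent_rcons (u := [::])) //; last first.
    by move: Xb; rewrite XE all_cat => /andP[].
  rewrite /splits big_seq1 /= fert1 !mul1n !mulnDr big_distrr /=.
  by congr (_ + _); apply: eq_bigr => q _; rewrite mulnA.
rewrite (big_splits (fun a c => fert a * fert (b :: c ++ rcons v m))).
rewrite (eq_big_seq _ E) !big_split /=.
(* When [p.2] is empty there is no descent after [b], so this term is expanded separately. *)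
rewrite -[b :: rcons v m]cat1s (fert_cat_rcons (u := [:: b])) //= ?bm //.
rewrite big_seq1 /= mul1n mulnDr.
rewrite (fert_descent_rcons (u := [::])) // [in RHS]/splits big_seq1 /=.
rewrite fert1 !mul1n -/(splits v) (fert_cat_rcons Xm vm).
have := IHv; rewrite (big_splits (fun a c => fert a * fert (b :: c ++ v))) /=.
(* The induction hypothesis at every prefix of [v], weighted by the fertility of the remaining
   factor. *)
have : \sum_(i <- proper_splits X) \sum_(q <- splits v)
          fert i.1 * fert (b :: i.2 ++ q.1) * fert q.2 +
       fert X * \sum_(p <- splits v) fert (b :: p.1) * fert p.2 =
       \sum_(p <- splits v) fert (b :: X ++ p.1) * fert p.2 +
       \sum_(p <- splits v) fert (X ++ p.1) * fert p.2.
  rewrite exchange_big big_distrr -!big_split; apply: eq_big_seq => p /IH.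
  rewrite (big_splits (fun a c => fert a * fert (b :: c ++ p.1))) /=.
  by rewrite -mulnDl => <-; rewrite mulnDl big_distrl mulnA.
sum_lia.
Qed.

(** Induction on [v] for all [X] at once, since a cut inside [X] leaves a suffix of [X]. On the left
    there remain the terms [fert p.1 * fert (b :: p.2 ++ v)] over all splits of [X]; by
    [fert_contract] they equal the cuts of [b X v] just before and just after [b]. *)
Lemma fert_move_first X v :
  X != [::] -> all (ltn^~ b) X -> gt_head b v ->
  fert (X ++ b :: v) =
    fert (b :: X ++ v) + fert (X ++ v) +
    \sum_(p <- proper_splits X) fert p.1 * fert (p.2 ++ v).
Proof.
move=> X0 Xb hv; move: v hv X X0 Xb.
apply: gt_head_ind => [|v m vm|v m vm bm hv IHv IH] X X0 Xb.
- rewrite cats1 fert_rcons Xb !cats0 (fert_descent_eq0 [::] X0 Xb) add0n.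
  rewrite (big_splits (fun a c => fert a * fert c)) muln1 addnC.
  by congr (_ + _); apply: eq_bigr => p _; rewrite cats0.
- rewrite -[b :: X ++ _]cat_cons -rcons_cons !fert_cat_rcons_eq0 //=; last first.
    by rewrite (negPf vm) andbF.
  by rewrite big1 // => p _; rewrite fert_cat_rcons_eq0 ?muln0.
have Xm : all (ltn^~ m) X by apply: sub_all Xb => x xb; apply: ltn_trans bm.
have sX p : p \in proper_splits X ->
    [/\ p.2 != [::], all (ltn^~ b) p.2 & all (ltn^~ m) p.2].
  rewrite mem_proper_splits => /andP[/eqP XE p0].
  by split=> //; [move: Xb | move: Xm]; rewrite XE all_cat => /andP[].
rewrite -rcons_cons fert_cat_rcons ?Xm //= ?bm ?vm //.
rewrite (big_splits_cons (fun a c => fert (X ++ a) * fert c)) /= cats0.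
rewrite (fert_descent_rcons (u := [::])) // /splits big_seq1 /= fert1 !mul1n.
rewrite -/(splits v) (fert_cat_rcons Xm vm).
have E1 p : p \in proper_splits X -> fert p.1 * fert (p.2 ++ b :: v) =
    fert p.1 * fert (b :: p.2 ++ v) + fert p.1 * fert (p.2 ++ v) +
    fert p.1 * \sum_(q <- proper_splits p.2) fert q.1 * fert (q.2 ++ v).
  by move=> /sX[p0 pb _]; rewrite IHv // !mulnDr.
have E2 p : p \in proper_splits X -> fert p.1 * fert (p.2 ++ rcons v m) =
    fert p.1 * (\sum_(q <- proper_splits p.2) fert q.1 * fert (q.2 ++ v)) +
    fert p.1 * (\sum_(q <- splits v) fert (p.2 ++ q.1) * fert q.2).
  by move=> /sX[p0 pb pm]; rewrite fert_cat_rcons // mulnDr.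
have E3 : \sum_(p <- splits v) fert (X ++ b :: p.1) * fert p.2 =
    \sum_(p <- splits v) fert (b :: X ++ p.1) * fert p.2 +
    \sum_(p <- splits v) fert (X ++ p.1) * fert p.2 +
    \sum_(p <- proper_splits X)
      fert p.1 * \sum_(q <- splits v) fert (p.2 ++ q.1) * fert q.2.
  under [X in _ = _ + X]eq_bigr do rewrite big_distrr.
  rewrite exchange_big -!big_split; apply: eq_big_seq => p /IH -> //=.
  rewrite !mulnDl big_distrl; congr (_ + _).
  by apply: eq_bigr => q _; rewrite mulnA.
rewrite (eq_big_seq _ E1) (eq_big_seq _ E2) E3 !big_split /=.
have := fert_contract X0 Xb hv.
rewrite (big_splits (fun a c => fert a * fert (b :: c ++ v))) /=.
sum_lia.
Qed.
End Move.

(** * Moving a letter behind an arbitrary left context *)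

Lemma fert_move_rcons b u X v m :
  all (ltn^~ b) X -> b < m -> all (ltn^~ m) u -> all (ltn^~ m) v ->
  fert (u ++ X ++ b :: rcons v m) =
    \sum_(p <- proper_splits u) fert p.1 * fert (p.2 ++ X ++ b :: v) +
    \sum_(p <- splits X) fert (u ++ p.1) * fert (p.2 ++ b :: v) +
    \sum_(p <- splits v) fert (u ++ X ++ b :: p.1) * fert p.2.
Proof.
move=> Xb bm um vm.
have Xm : all (ltn^~ m) X by apply: sub_all Xb => x xb; apply: ltn_trans bm.
rewrite -rcons_cons catA fert_cat_rcons ?all_cat ?um ?Xm //= ?bm ?vm //.
rewrite proper_splits_cat big_cat !big_map /=.
rewrite (big_splits_cons (fun a c => fert ((u ++ X) ++ a) * fert c)).
rewrite (big_splits (fun a c => fert (u ++ a) * fert (c ++ b :: v))) cats0.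
rewrite !addnA; congr (_ + _ + _ + _).
  by apply: eq_bigr => p _; rewrite catA.
by apply: eq_bigr => p _; rewrite catA.
Qed.

(** The surplus [fert u * fert (X ++ v)] makes the induction work. The cut just after [b] has no
    counterpart on the right; it contributes [fert (rcons u b) * fert (X ++ v)], a sum over the
    splits of [u]. Each proper split is paid by the surplus for the corresponding suffix of [u], the
    last one by [fert_move_first]. *)
Lemma fert_move_lt b u X v :
  X != [::] -> all (ltn^~ b) X -> all (ltn^~ b) u -> gt_head b v ->
  fert (u ++ b :: X ++ v) + fert u * fert (X ++ v) <= fert (u ++ X ++ b :: v).
Proof.
move=> X0 Xb ub hv; move: v hv u ub.
apply: gt_head_ind => [|v m vm|v m vm bm hv IHv IH] u ub.
- rewrite !cats0 fert_descent_eq0 // catA cats1 fert_rcons all_cat ub Xb add0n.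
  rewrite (big_splits_cat (fun a c => fert a * fert c)).
  case: X X0 Xb => // x X _ _.
  rewrite (big_splits_cons (fun a c => fert (u ++ a) * fert c)) cats0 /=.
  sum_lia.
- rewrite -cat_cons catA -rcons_cons catA !fert_cat_rcons_eq0 ?muln0 //=.
  by rewrite (negPf vm) andbF.
have um : all (ltn^~ m) u by apply: sub_all ub => x xb; apply: ltn_trans bm.
have Xm : all (ltn^~ m) X by apply: sub_all Xb => x xb; apply: ltn_trans bm.
rewrite fert_descent_rcons // fert_move_rcons // fert_cat_rcons //.
rewrite fert_rcons ub.
rewrite (big_splits (fun a c => fert a * fert (c ++ b :: X ++ v))) /=.
rewrite (big_splits (fun a c => fert a * fert c)) /= muln1.
have E1 : \sum_(p <- proper_splits u) fert p.1 * fert (p.2 ++ b :: X ++ v) +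
    (\sum_(p <- proper_splits u) fert p.1 * fert p.2) * fert (X ++ v) <=
    \sum_(p <- proper_splits u) fert p.1 * fert (p.2 ++ X ++ b :: v).
  rewrite big_distrl -big_split; apply: leq_sum_seq => p.
  rewrite mem_proper_splits /= => /andP[/eqP uE _].
  rewrite -mulnA -mulnDr leq_mul2l IHv ?orbT //.
  by move: ub; rewrite uE all_cat => /andP[].
have E2 : \sum_(p <- splits v) fert (u ++ b :: X ++ p.1) * fert p.2 +
    fert u * (\sum_(p <- splits v) fert (X ++ p.1) * fert p.2) <=
    \sum_(p <- splits v) fert (u ++ X ++ b :: p.1) * fert p.2.
  rewrite big_distrr -big_split; apply: leq_sum_seq => p pv /=.
  by rewrite mulnA -mulnDl leq_mul2r IH ?orbT.
(* Of the cuts running through [X], only the one just before [X] is kept; the exact formula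
   evaluates it. *)
have E3 : fert u * fert (X ++ b :: v) <=
    \sum_(p <- splits X) fert (u ++ p.1) * fert (p.2 ++ b :: v).
  case: X X0 {Xb Xm IHv IH E1 E2} => // x X _.
  rewrite (big_splits_cons (fun a c => fert (u ++ a) * fert (c ++ b :: v))).
  by rewrite cats0 leq_addr.
move: E3; rewrite (fert_move_first X0 Xb hv) !mulnDr.
move: E1 E2; rewrite mulnDl.
sum_lia.
Qed.

(** * Positive fertility and strict growth *)

Lemma fert_rcons_gt0 a c m :
  all (ltn^~ m) (a ++ c) -> 0 < fert a -> 0 < fert c ->
  0 < fert (rcons (a ++ c) m).
Proof.
move=> hm a0 c0; rewrite fert_rcons hm lt0n sum_nat_seq_neq0.
by apply/hasP; exists (a, c); rewrite ?mem_splits //= -lt0n muln_gt0 a0.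
Qed.

(** It suffices to delete one first letter. In a cut with nonzero contribution that letter opens the
    first nonempty factor; by induction this factor stays fertile without it, and the cut
    survives. *)
Lemma fert_suffix_gt0 u v : 0 < fert (u ++ v) -> 0 < fert v.
Proof.
suff H x w : 0 < fert (x :: w) -> 0 < fert w by elim: u => // x u IH /H/IH.
have [k] := ubnP (size w); elim: k w => // k IH.
case/lastP=> [//|w m]; rewrite size_rcons ltnS => szw.
rewrite -rcons_cons fert_rcons /=; case: ifP => // /andP[_ wm].
rewrite lt0n sum_nat_seq_neq0 => /hasP[[a c]].
rewrite mem_splits /= -lt0n muln_gt0 => /eqP wE /andP[a0 c0].
case: a wE a0 => [|y a] /= wE a0.
  by apply: (@fert_rcons_gt0 [::]) => //; apply: IH; rewrite // wE.
case: wE szw wm => ? ->; subst y; rewrite size_cat => szw wm.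
by apply: fert_rcons_gt0 => //; apply: IH a0; lia.
Qed.

Lemma fert_stack_sort_gt0 w : uniq w -> 0 < fert (stack_sort_word w).
Proof. by move/mem_preimages; rewrite /fert; case: preimages. Qed.

(* A relation which, unlike strict inequality alone, passes to sums and
   products term by term. *)
Definition zero_or_lt (a c : nat) : bool := (a == 0) || (a < c).

Lemma zero_or_ltW a c : zero_or_lt a c -> a <= c.
Proof. by rewrite /zero_or_lt; lia. Qed.

Lemma zero_or_ltD a c a' c' :
  zero_or_lt a c -> zero_or_lt a' c' -> zero_or_lt (a + a') (c + c').
Proof. by rewrite /zero_or_lt; lia. Qed.

Lemma zero_or_ltM a c d : zero_or_lt a c -> zero_or_lt (d * a) (d * c).
Proof. by rewrite /zero_or_lt muln_eq0 ltn_mul2l; lia. Qed.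

Lemma zero_or_lt_sum (I : eqType) (r : seq I) (F G : I -> nat) :
  {in r, forall i, zero_or_lt (F i) (G i)} ->
  zero_or_lt (\sum_(i <- r) F i) (\sum_(i <- r) G i).
Proof.
move=> H; rewrite !big_seq.
apply: (big_ind2 zero_or_lt) => // *; exact: zero_or_ltD.
Qed.

(* The hypothesis on suffixes cannot be dropped: 21304 and 21034 both have
   exactly one preimage. *)
Lemma fert_move b u X v :
  X != [::] -> all (ltn^~ b) X -> gt_head b v ->
  (forall u1 u2, u = u1 ++ u2 -> all (ltn^~ b) u2 -> 0 < fert u2) ->
  zero_or_lt (fert (u ++ b :: X ++ v)) (fert (u ++ X ++ b :: v)).
Proof.
move=> X0 Xb hv; move: (v) hv u.
apply: gt_head_ind => [|{}v m vm|{}v m vm bm hv IHv IH] u hu.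
- by rewrite cats0 fert_descent_eq0.
- by rewrite -cat_cons catA fert_cat_rcons_eq0.
have [ub|nub] := boolP (all (ltn^~ b) u).
  have hv' : gt_head b (rcons v m) by case: (v) hv.
  have := fert_move_lt X0 Xb ub hv'.
  (* The surplus in [fert_move_lt] is positive: [fert u] by hypothesis, the other factor because
     [X ++ rcons v m] is a suffix of a word of nonzero fertility. *)
  have u0 : 0 < fert u by apply: (hu [::]).
  rewrite /zero_or_lt; case: posnP => //= d0.
  have := d0; rewrite -cat_rcons => /fert_suffix_gt0 X1.
  by apply: leq_trans; rewrite -addn1 leq_add2l muln_gt0 u0.
have [um|num] := boolP (all (ltn^~ m) u); last first.
  by rewrite -cat_cons catA -rcons_cat fert_rcons !all_cat (negPf num).
rewrite fert_descent_rcons // fert_move_rcons // fert_rcons (negPf nub) addn0.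
apply: zero_or_ltD; last first.
  apply: zero_or_lt_sum => p pv; rewrite ![_ * fert p.2]mulnC.
  exact/zero_or_ltM/IH.
rewrite (big_splits (fun a c => fert a * fert (c ++ b :: X ++ v))) /=.
have hs p : p \in splits u -> zero_or_lt (fert p.1 * fert (p.2 ++ b :: X ++ v))
    (fert p.1 * fert (p.2 ++ X ++ b :: v)).
  rewrite mem_splits => /eqP uE; apply/zero_or_ltM/IHv => u1 u2 pE.
  by apply: (hu (p.1 ++ u1)); rewrite uE pE catA.
apply: zero_or_ltD.
  by apply: zero_or_lt_sum => p pu; apply: hs; rewrite mem_rcons inE pu orbT.
(* The cut just before [b] on the left is compared with the cut just before [X] on the right. *)
have := hs (u, [::]); rewrite mem_splits cats0 eqxx => /(_ isT) /=.
case: X X0 {Xb IHv IH hs} => // x X _.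
rewrite (big_splits_cons (fun a c => fert (u ++ a) * fert (c ++ b :: v))).
rewrite cats0 /zero_or_lt => /orP[->//|h]; apply/orP; right.
exact: leq_trans h (leq_addr _ _).
Qed.

(** * Sorting a factor in context *)

Lemma stack_sort_sorted w : sorted ltn w -> stack_sort_word w = w.
Proof.
elim/last_ind: w => // w m IH.
rewrite -cats1 => sw; rewrite (@stack_sort_word_split w [::]) //.
  rewrite cats0 IH ?cats1 //.
  by move: sw; rewrite cats1;
    apply: subseq_sorted (subseq_rcons _ _); apply: ltn_trans.
apply/allP => x xw; move: sw; rewrite (sorted_pairwise ltn_trans) pairwise_cat.
by rewrite allrel1r => /andP[/allP/(_ x xw)].
Qed.

(** The default [0] is never read, as empty [u] is accepted first. *)
Definition last_gt (u : seq nat) (w : seq nat) : bool :=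
  (u == [::]) || all (ltn^~ (last 0 u)) w.

(** Strictness comes from moving [m] if [R] is nonempty; otherwise [L m] is unsorted only if [L] is,
    and induction applies to [L]. *)
Lemma fert_stack_sort_context w : uniq w ->
  forall u v, last_gt u w -> all (gt_head^~ v) w ->
  fert (u ++ w ++ v) <= fert (u ++ stack_sort_word w ++ v) /\
  (~~ sorted ltn w ->
   zero_or_lt (fert (u ++ w ++ v)) (fert (u ++ stack_sort_word w ++ v))).
Proof.
move: w; apply: uniq_max_ind => // L m R Lm Rm uL uR iL iR u v.
rewrite /last_gt !all_cat /= => hu /and3P[hLv mv hRv].
have [] := iL u (m :: R ++ v).
- by move: hu; rewrite /last_gt; case: eqP => //= _ /andP[].
- by apply: sub_all Lm => x /=.
have [] := iR (u ++ rcons (stack_sort_word L) m) v.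
- by rewrite /last_gt last_cat last_rcons Rm orbT.
- by [].
rewrite stack_sort_word_split // -!catA cat_rcons -!cats1 -!catA /=.
set sL := stack_sort_word L; set sR := stack_sort_word R.
move=> leR ltR leL ltL.
have step : R != [::] ->
    zero_or_lt (fert (u ++ sL ++ m :: sR ++ v))
               (fert (u ++ sL ++ sR ++ m :: v)).
  move=> R0; rewrite !(catA u sL); apply: fert_move.
  - by rewrite -size_eq0 (perm_size (perm_stack_sort_word R)) size_eq0.
  - by rewrite all_stack_sort.
  - by [].
  (* The last letter of [u], if any, exceeds [m], so a suffix below [m] lies within [sL]; it is
     fertile because [sL] has the preimage [L]. *)
  move=> u1 u2 uE u2m.
  have szE := congr1 size uE; rewrite !size_cat in szE.
  have [lt|ge] := ltnP (size u1) (size u).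
    have u0 : 0 < size u by apply: leq_ltn_trans lt.
    case/orP: hu => [/eqP uN|/and3P[_ mu _]]; first by rewrite uN in u0.
    have : nth 0 (u ++ sL) (size u).-1 \in u2.
      have le : size u1 <= (size u).-1 by rewrite -ltnS prednK.
      rewrite uE nth_cat ifN -?leqNgt // mem_nth // ltn_subLR //.
      by rewrite -szE prednK // leq_addr.
    rewrite nth_cat prednK // leqnn nth_last => /(allP u2m) /=.
    by rewrite ltnNge ltnW.
  apply: (@fert_suffix_gt0 (drop (size u) u1)).
  suff <- : sL = drop (size u) u1 ++ u2 by apply: fert_stack_sort_gt0.
  have := congr1 (drop (size u)) uE; rewrite drop_size_cat // => ->.
  rewrite drop_cat; case: ltngtP ge => // uu1 _.
  by rewrite uu1 subnn drop0 drop_size.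
have [R0|/step {}step] := eqVneq R [::].
  rewrite /sR R0 /= in leL ltL *; split=> // nsort; apply: ltL.
  apply: contra nsort; rewrite !(sorted_pairwise ltn_trans) pairwise_cat => ->.
  by rewrite allrel1r /= !andbT.
have le := leq_trans leL leR.
split=> [|_]; first exact: leq_trans le (zero_or_ltW step).
by move: le step; rewrite /zero_or_lt; lia.
Qed.

Theorem theorem1p2 (n : nat) (sigma : perms n) :
  fertility sigma <= fertility (stack_sort sigma) /\
  (fertility sigma = fertility (stack_sort sigma) <-> one_line sigma = iota 1 n).
Proof.
rewrite !fertility_fert /= -/(one_line sigma).
have pw : perm_eq (one_line sigma) (iota 1 n).
  by rewrite -mem_permutations; apply: ssvalP.
have uw : uniq (one_line sigma) by rewrite (perm_uniq pw) iota_uniq.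
have := @fert_stack_sort_context _ uw [::] [::] isT.
rewrite all_predT /= !cats0 => /(_ isT) [le lt]; split=> //; split=> [E|->].
  have [sw|/lt] := boolP (sorted ltn (one_line sigma)).
    apply: (@sorted_eq _ ltn) pw => //; first exact: ltn_trans.
      by move=> x y /andP[/ltnW xy /ltnW yx]; apply/eqP; rewrite eqn_leq xy.
    exact: iota_ltn_sorted.
  (* Equality at an unsorted word would force fertility zero, yet the sorted image has that word as
     a preimage. *)
  rewrite E /zero_or_lt ltnn orbF => /eqP s0.
  by have := fert_stack_sort_gt0 uw; rewrite s0.
by rewrite stack_sort_sorted ?iota_ltn_sorted.
Qed.
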